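(* Let $\Sigma$ be the direct product of $n$ discrete-time control systems $\Sigma_1,\ldots,\Sigma_n$ with control value sets $U_1,\ldots,U_n$, and let $Q$ be a controlled invariant set of $\Sigma$. The following assertions hold: (a) The network entropy set satisfies $H(Q)=\operatorname{cl}\bigcup_{\tau>0}H_\tau(Q)$. In particular, $H(Q)$ is nonempty and closed. (b) Assume that each of the control value sets $U_i$ contains at least two elements. If $\xi\in H(Q)$ and $\eta\in\mathbb{R}^n$ satisfies $\eta\ge\xi$ componentwise, then $\eta\in H(Q)$. In particular, $H(Q)$ is unbounded. (c) The set $H(Q)$ is convex. (d) For any $(h_1,\ldots,h_n)\in H(Q)$ it holds that $h_{\mathrm{inv}}(Q)\le\sum_{i=1}^n h_i$. (e) The set $H(Q)$ contains $(h_{\mathrm{inv}}(Q),\ldots,h_{\mathrm{inv}}(Q))$, provided that $\#U_i\ge2$ for all $i$.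
   Context: Logarithms are to base 2; $\mathbb{Z}_+$ denotes the nonnegative integers; $\tau,t$ range over positive integers. For $j=1,\ldots,n$, $\Sigma_j$ is a control system $x^{(j)}_{k+1}=f_j(x^{(j)}_k,u^{(j)}_k)$, $k\ge0$, where $X_j$ is a topological space, $U_j$ a nonempty set and $f_j:X_j\times U_j\to X_j$ is continuous in its first argument. Put $\mathcal{U}_j=U_j^{\mathbb{Z}_+}$. The overall system $\Sigma$ has state space $X=X_1\times\cdots\times X_n$ (product topology), control value set $U=U_1\times\cdots\times U_n$, control sequences $\mathcal{U}=\mathcal{U}_1\times\cdots\times\mathcal{U}_n$; $\varphi(k,x,\omega)\in X$ denotes the state at time $k$ of $\Sigma$ started at $x\in X$ under $\omega\in\mathcal{U}$ (each subsystem evolving independently with its own control sequence). A compact set $Q\subset X$ with nonempty interior is controlled invariant if for every $x\in Q$ there is $u\in U$ with $(f_1(x_1,u_1),\ldots,f_n(x_n,u_n))\in\operatorname{int}Q$. A set $\mathcal{S}\subset\mathcal{U}$ is $(\tau,Q)$-spanning if for every $x\in Q$ there is $\omega\in\mathcal{S}$ with $\varphi(k,x,\omega)\in\operatorname{int}Q$ for $k=1,\ldots,\tau$; $r_{\mathrm{inv}}(\tau,Q)$ is the minimal cardinality of such a set, and the invariance entropy is $h_{\mathrm{inv}}(Q)=\lim_{\tau\to\infty}\frac1\tau\log r_{\mathrm{inv}}(\tau,Q)$ (the limit exists and equals the infimum over $\tau>0$). For $\tau>0$ let $$H_\tau(Q)=\left\{\tfrac1\tau(\log\#\mathcal{S}_1,\ldots,\log\#\mathcal{S}_n):\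 \mathcal{S}_i\subset\mathcal{U}_i,\ \mathcal{S}_1\times\cdots\times\mathcal{S}_n\text{ finite and }(\tau,Q)\text{-spanning}\right\}\subset\mathbb{R}^n.$$ The network entropy set of $\Sigma$ is defined as $H(Q)=\bigcap_{\tau>0}\operatorname{cl}\bigcup_{t\ge\tau}H_t(Q)$. *)

(* Defs.v *)
From HB Require Import structures.
From mathcomp Require Import all_boot all_order all_algebra.
From mathcomp Require Import all_classical all_reals all_analysis.

Set Implicit Arguments.
Unset Strict Implicit.
Unset Printing Implicit Defensive.

Import Order.TTheory GRing.Theory Num.Theory.
Import numFieldNormedType.Exports.

Local Open Scope classical_set_scope.
Local Open Scope ring_scope.

Record control_system := ControlSystem {
  state : topologicalType;
  control : Type;
  step : state -> control -> state;
  control_nonempty : inhabited control;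
  step_continuous : forall u : control, continuous (step^~ u)
}.

Fixpoint trajectory (S : control_system) (x : state S) (u : nat -> control S)
    (k : nat) : state S :=
  if k is k'.+1 then step (trajectory x u k') (u k') else x.

Section direct_product.
Variables (n : nat) (Sigma : 'I_n -> control_system).

Definition product_state : topologicalType :=
  prod_topology (fun j => state (Sigma j)).

Definition product_control : Type := forall j, control (Sigma j).

Definition product_step (x : product_state) (u : product_control) :
  product_state := fun j => step (x j) (u j).

(* The product of the sequence spaces; a control sequence of the product is an
   n-tuple of sequences rather than a sequence of n-tuples. *)
Definition control_seq : Type := forall j, nat -> control (Sigma j).

Definition phi (k : nat) (x : product_state) (w : control_seq) :
  product_state := fun j => trajectory (x j) (w j) k.

Definition controlled_invariant (Q : set product_state) : Prop :=
  [/\ compact Q, Q° !=set0 &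
      forall x, Q x -> exists u : product_control, Q° (product_step x u)].

Definition spanning (tau : nat) (Q : set product_state)
    (S : set control_seq) : Prop :=
  forall x, Q x -> exists2 w, S w &
    forall k, (1 <= k <= tau)%N -> Q° (phi k x w).

Definition seq_box (S : forall j, set (nat -> control (Sigma j))) :
  set control_seq := [set w | forall j, S j (w j)].

End direct_product.

Section entropy.
Variables (R : realType) (n : nat) (Sigma : 'I_n -> control_system).
Implicit Type Q : set (product_state Sigma).

Definition log2 (x : R) : R := ln x / ln 2.

(* Infimum of a set of natural numbers, hence a minimum if a finite spanning
   set exists, and +oo otherwise. *)
Definition r_inv (tau : nat) Q : \bar R :=
  ereal_inf [set m%:R%:E | m in
    [set m : nat | exists2 S, spanning tau Q S & (S #= `I_m)%card]].

Definition h_inv Q : \bar R :=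
  limn (fun tau : nat => ((tau%:R^-1)%:E * er_map log2 (r_inv tau Q))%E).

Definition H_ (tau : nat) Q : set 'rV[R]_n :=
  [set v | exists S : forall j, set (nat -> control (Sigma j)),
    [/\ finite_set (seq_box S), spanning tau Q (seq_box S) &
        exists m : 'I_n -> nat, (forall j, (S j #= `I_(m j))%card) /\
          v = \row_j (tau%:R^-1 * log2 (m j)%:R)]].

Definition network_entropy_set Q : set 'rV[R]_n :=
  \bigcap_(tau in [set tau | (0 < tau)%N])
    closure (\bigcup_(t in [set t | (tau <= t)%N]) H_ t Q).

End entropy.

Arguments h_inv R {n Sigma} Q.
Arguments H_ R {n Sigma} tau Q.
Arguments network_entropy_set R {n Sigma} Q.

(* Main.v *)
Require Import Defs.
From HB Require Import structures.
From mathcomp Require Import all_boot all_order all_algebra.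
From mathcomp Require Import all_classical all_reals all_analysis.
From mathcomp Require Import ring lra.

Set Implicit Arguments.
Unset Strict Implicit.
Unset Printing Implicit Defensive.

Import Order.TTheory GRing.Theory Num.Theory.
Import numFieldNormedType.Exports.

Local Open Scope classical_set_scope.
Local Open Scope ring_scope.
Local Open Scope card_scope.

(** Splicing a box that spans [s] steps with one that spans [t] steps gives a
    box that spans [s + t] steps, and the cardinalities of the factors multiply;
    so the sets [H_t], scaled by [t], form an additive family.  Repeating one box
    shows that [H_t] is contained in [H_(k t)], which gives (a), and mixing
    repetitions of two boxes gives all rational convex combinations, hence (c).
    Enlarging a factor of a box moves its logarithmic rate up in steps of at
    most [1 / t], hence (b).  A box of sides [m_j] has [\prod_j m_j] elements,
    which gives (d), and the projections of a minimal spanning set to the factors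
    span a box whose sides are at most [r_inv], which gives (e).

    Two sequences may have the same first [s] terms, so a spliced set can have
    fewer elements than the product of the two cardinalities.  It is enlarged to
    the exact number, which is possible since a factor with at least two control
    values has infinitely many control sequences, and with a single value all
    cardinalities are 1. *)

(** * Cardinality of sets of control sequences *)

Lemma card_le_superset T (A : set T) m :
  A #<= `I_m -> A #= `I_m \/ infinite_set [set: T] ->
  exists2 B, A `<=` B & B #= `I_m.
Proof.
move=> Am [Aeq|]; first by exists A.
elim/Ppointed: T => T in A Am *.
  by case; rewrite emptyE; exact: finite_set0.
move=> infT.
have finA : finite_set A by apply/finite_set_leP; exists m.
have [a Aa] := finA.
have am : (a <= m)%N by rewrite -card_le_II -(card_le_eql Aa).
have /pcard_eqP[g] := card_esym Aa.
have /infiniteP/pcard_leP[f] := infinite_setD infT finA.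
have fA i : ~ A (f i) by have [] := @funS _ _ _ _ f i I.
have gA i : (i < a)%N -> A (g i) by move=> ia; exact: (@funS _ _ _ _ g i ia).
(* [h] runs through [A] on the first [a] indices and continues in the complement of [A], which is
   infinite since [A] is finite; its first [m] values are the required superset. *)
pose h i := if (i < a)%N then g i else f i.
exists (h @` `I_m); last first.
  apply: inj_card_eq => i j _ _; rewrite /h.
  case: ifPn => ia; case: ifPn => ja.
  - by apply: (@inj _ _ _ g); rewrite inE.
  - by move=> E; have := gA _ ia; rewrite E => /fA.
  - by move=> E; have := gA _ ja; rewrite -E => /fA.
  - by apply: (@inj _ _ _ f); rewrite inE.
move=> x Ax; have [i ia <-] := @surj _ _ _ _ g x Ax.
by exists i; [exact: (leq_trans ia am)|rewrite /h ifT].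
Qed.

Lemma card_le_sub_image T (A : set T) m : inhabited T ->
  A #<= `I_m -> exists g : nat -> T, A `<=` g @` `I_m.
Proof.
elim/Ppointed: T => T in A *; first by case=> x; case: (no x).
by move=> _ /pcard_surjP.
Qed.

Lemma card_image2_le T U V (f : T -> U -> V) (A : set T) (B : set U) m p :
  inhabited T -> inhabited U -> A #<= `I_m -> B #<= `I_p ->
  [set f a b | a in A & b in B] #<= `I_(m * p).
Proof.
move=> iT iU /(card_le_sub_image iT)[g Ag] /(card_le_sub_image iU)[h Bh].
apply: (@card_le_trans _ _ _
  ((fun i => f (g (i %/ p)%N) (h (i %% p)%N)) @` `I_(m * p))).
  apply: subset_card_le => _ [a /Ag[i im <-] [b /Bh[j jp <-] <-]].
  have p0 : (0 < p)%N by exact: leq_ltn_trans jp.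
  (* The pair [(i, j)] is coded by one index and recovered by division with remainder by [p]. *)
  exists (i * p + j)%N.
    rewrite /=; apply: (@leq_trans (i.+1 * p)%N).
      by rewrite mulSn addnC ltn_add2r.
    by rewrite leq_pmul2r.
  by rewrite divnMDl// divn_small// addn0 modnMDl modn_small.
exact: card_image_le.
Qed.

Lemma infinite_seq U : (exists u v : U, u <> v) ->
  infinite_set [set: nat -> U].
Proof.
move=> [u [v uv]]; apply/infiniteP.
(* The sequences equal to [u] at time [k] only are pairwise distinct. *)
pose f (k i : nat) := if i == k then u else v.
apply: (@card_le_trans _ _ _ (range f)); last exact: subset_card_le.
rewrite -(card_le_eql (@inj_card_eq _ _ [set: nat] f _)) //.
move=> k l _ _ /(congr1 (@^~ k)); rewrite /f eqxx.
by case: eqP => [->//|_ /uv].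
Qed.

Lemma subsingleton_seq_card1 U (A : set (nat -> U)) :
  ~ (exists u v : U, u <> v) -> A !=set0 -> A #= `I_1.
Proof.
move=> sub [a Aa]; suff -> : A = [set a] by exact: card_set1.
apply/seteqP; split=> [b _|_ -> //].
apply: funext => i; apply: contrapT => ba.
by apply: sub; exists (b i), (a i).
Qed.

(** * Splicing of control sequences *)

Definition splice (T : Type) (s : nat) (u v : nat -> T) (k : nat) : T :=
  if (k < s)%N then u k else v (k - s)%N.

Lemma trajectory_splice_le (S : control_system) (x : state S) u v s k :
  (k <= s)%N -> trajectory x (splice s u v) k = trajectory x u k.
Proof.
elim: k => // k IHk ks /=; rewrite IHk ?(ltnW ks)//.
by rewrite /splice ks.
Qed.

Lemma trajectory_splice_add (S : control_system) (x : state S) u v s k :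
  trajectory x (splice s u v) (s + k) = trajectory (trajectory x u s) v k.
Proof.
elim: k => [|k IHk]; first by rewrite addn0 trajectory_splice_le.
by rewrite addnS /= IHk /splice ltnNge leq_addr /= addKn.
Qed.

Lemma product_step_continuous n (Sigma : 'I_n -> control_system)
    (u : product_control Sigma) :
  continuous ((@product_step n Sigma)^~ u).
Proof.
move=> x; have FF : Filter (product_step y u @[y --> x]) by exact: fmap_filter (nbhs_filter x).
(* The product topology is the supremum of the topologies pulled back along the projections, so one
   coordinate [i] can be treated at a time. *)
apply/cvg_sup => i A /= [_ [[C Copen <-] Cx] CA].
have Cstep : nbhs (x i) [set y | C (step y (u i))].
  have := @step_continuous (Sigma i) (u i) (x i) C.
  by apply; exact: open_nbhs_nbhs.
have := @proj_continuous _ (fun j => state (Sigma j)) i x _ Cstep.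
by apply: (@filterS _ (nbhs x)) => y Cy; exact: CA.
Qed.

(** * Boxes that span a given number of steps *)

Section spanning_boxes.
Variables (n : nat) (Sigma : 'I_n -> control_system).
Variable Q : set (product_state Sigma).
Implicit Types (s t : nat) (m : 'I_n -> nat).

(** The first sequence brings the state back into [Q] at time [s], and the second is chosen for the
    state reached there. *)
Lemma spanning_splice s t (A B C : set (control_seq Sigma)) :
  spanning s Q A -> spanning t Q B ->
  (forall a b, A a -> B b -> C (fun j => splice s (a j) (b j))) ->
  spanning (s + t) Q C.
Proof.
move=> sA tB ABC x Qx; have [a Aa aQ] := sA _ Qx.
have Qxs : Q (phi s x a).
  (* Spanning constrains only times [k >= 1]; at [s = 0] the state is still [x]. *)
  case: s aQ {sA ABC} => [|s] aQ; first exact: Qx.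
  by apply: interior_subset; apply: aQ; rewrite leqnn.
have [b Bb bQ] := tB _ Qxs; exists (fun j => splice s (a j) (b j)).
  exact: ABC.
move=> k /andP[k1 kst]; have [ks|sk] := leqP k s.
  have -> : phi k x (fun j => splice s (a j) (b j)) = phi k x a.
    by apply: functional_extensionality_dep => j; rewrite /phi trajectory_splice_le.
  by apply: aQ; rewrite k1.
have kE : k = (s + (k - s))%N by rewrite subnKC// ltnW.
have -> : phi k x (fun j => splice s (a j) (b j)) = phi (k - s) (phi s x a) b.
  apply: functional_extensionality_dep => j.
  by rewrite /phi {1}kE trajectory_splice_add.
by apply: bQ; rewrite subn_gt0 sk leq_subLR.
Qed.

Lemma seq_inhabited j : inhabited (nat -> control (Sigma j)).
Proof. by have [u] := control_nonempty (Sigma j); exact: inhabits (fun=> u). Qed.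

(** Enumerations of the factors map the finite type of dependent index functions onto a superset of
    the box. *)
Lemma seq_box_card_le (S : forall j, set (nat -> control (Sigma j))) m :
  (forall j, S j #= `I_(m j)) -> seq_box S #<= `I_(\prod_j m j)%N.
Proof.
move=> Sm.
have /all_sig[g gS] j : {g : nat -> nat -> control (Sigma j) |
    S j `<=` g @` `I_(m j)}.
  apply: cid; apply: card_le_sub_image; first exact: seq_inhabited.
  by have /card_eqPle[] := Sm j.
pose T : finType := {dffun forall j : 'I_n, 'I_(m j)}.
have -> : (\prod_j m j)%N = #|T|.
  rewrite /T card_dep_ffun foldrE big_map big_enum /=.
  by apply: eq_bigr => j _; rewrite card_ord.
pose F (f : T) : control_seq Sigma := fun j => g j (f j).
apply: (@card_le_trans _ _ _ (range F)).
  apply: subset_card_le => w Sw.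
  have /all_sig[h hw] j : {i : 'I_(m j) | g j i = w j}.
    by apply: cid; have [i im iw] := gS j _ (Sw j); exists (Ordinal im).
  exists [ffun j => h j] => //.
  by apply: functional_extensionality_dep => j; rewrite /F ffunE hw.
apply: (card_le_trans (card_image_le _ _)).
have /card_eqPle[_ +] := @card_II #|T|.
apply: card_le_trans.
suff -> : [set: T] = (@enum_val T T) @` [set: 'I_#|T|] by exact: card_image_le.
apply/seteqP; split=> // f _; exists (enum_rank f) => //.
by rewrite enum_rankK.
Qed.

(** Integer form of membership in [H_]: the sides are exact cardinalities, since [H_] takes the
    logarithms of exact cardinalities. *)
Definition box_spans t m := exists S : forall j, set (nat -> control (Sigma j)),
  (forall j, S j #= `I_(m j)) /\ spanning t Q (seq_box S).

Lemma box_spans_superset t m (S : forall j, set (nat -> control (Sigma j))) :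
  (forall j, S j #<= `I_(m j)) ->
  (forall j, S j #= `I_(m j) \/ infinite_set [set: nat -> control (Sigma j)]) ->
  spanning t Q (seq_box S) -> box_spans t m.
Proof.
move=> Sm Sinf SQ.
have /all_sig2[B SB Bm] j : {B | S j `<=` B & B #= `I_(m j)}.
  by apply: cid2; exact: card_le_superset.
exists B; split=> // x Qx; have [w Sw wQ] := SQ _ Qx.
by exists w => // j; apply: SB; exact: Sw.
Qed.

Hypothesis Q_inv : controlled_invariant Q.

Lemma controlled_invariant_nonempty : Q !=set0.
Proof. by have [_ [x Qx] _] := Q_inv; exists x; exact: interior_subset. Qed.

Lemma spanning_nonempty t S : spanning t Q S -> S !=set0.
Proof.
by have [x Qx] := controlled_invariant_nonempty; move=> /(_ _ Qx)[w Sw _]; exists w.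
Qed.

Lemma box_spans_gt0 t m j : box_spans t m -> (0 < m j)%N.
Proof.
move=> [S [Sm /spanning_nonempty[w Sw]]]; rewrite lt0n; apply/eqP => m0.
move: (Sm j); rewrite m0 II0 card_eq0 => /eqP S0.
by have := Sw j; rewrite S0.
Qed.

(** Two control values leave room to enlarge a factor to any prescribed size. With a single value
    the factor, nonempty because [Q] is, already has exactly one element. *)
Lemma box_spans_superset_nonempty t m
    (S : forall j, set (nat -> control (Sigma j))) :
  (forall j, S j #<= `I_(m j)) ->
  (forall j, (exists u v : control (Sigma j), u <> v) \/ m j = 1%N) ->
  spanning t Q (seq_box S) -> box_spans t m.
Proof.
move=> Sm m1 SQ; have [w Sw] := spanning_nonempty SQ.
apply: (box_spans_superset Sm) => // j.
have [uv|uv] := pselect (exists u v : control (Sigma j), u <> v).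
  by right; exact: infinite_seq.
left; have [//|->] := m1 j.
by apply: (subsingleton_seq_card1 uv); exists (w j); exact: Sw.
Qed.

Lemma box_spans_card1 t m j : box_spans t m ->
  (exists u v : control (Sigma j), u <> v) \/ m j = 1%N.
Proof.
move=> [S [Sm /spanning_nonempty[w Sw]]].
have [|uv] := pselect (exists u v : control (Sigma j), u <> v); first by left.
right; apply/card_eq_II; rewrite -(card_eql (Sm j)).
by apply: (subsingleton_seq_card1 uv); exists (w j); exact: Sw.
Qed.

Lemma box_spansD s t m m' : box_spans s m -> box_spans t m' ->
  box_spans (s + t) (fun j => m j * m' j)%N.
Proof.
move=> bs bt; have [[S [Sm SQ]] [S' [Sm' SQ']]] := (bs, bt).
apply: (@box_spans_superset_nonempty _ _
  (fun j => [set splice s a b | a in S j & b in S' j])).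
- move=> j; have /card_eqPle[Sj _] := Sm j; have /card_eqPle[S'j _] := Sm' j.
  by apply: card_image2_le => //; exact: seq_inhabited.
- move=> j; case: (box_spans_card1 j bs) => [|->]; first by left.
  by case: (box_spans_card1 j bt) => [|->]; [left|right].
- apply: (spanning_splice SQ SQ') => a b Sa Sb j.
  by exists (a j); [exact: Sa|exists (b j); [exact: Sb|]].
Qed.

Lemma box_spans0 : box_spans 0 (fun=> 1%N).
Proof.
have /all_sig[w _] j : {w : nat -> control (Sigma j) | True}.
  by apply: cid; have [w] := seq_inhabited j; exists w.
exists (fun j => [set w j]); split=> [j|x Qx]; first exact: card_set1.
by exists w => // k /andP[k1 /(leq_trans k1)].
Qed.

Lemma box_spansM t k m : box_spans t m ->
  box_spans (k * t) (fun j => m j ^ k)%N.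
Proof.
move=> bt; elim: k => [|k IHk]; first exact: box_spans0.
rewrite mulSn (_ : (fun j => m j ^ k.+1)%N = (fun j => m j * m j ^ k)%N).
  exact: box_spansD.
by apply: funext => j; rewrite expnS.
Qed.

Lemma box_spans_le t m m' :
  (forall i, exists u v : control (Sigma i), u <> v) ->
  (forall j, m j <= m' j)%N -> box_spans t m -> box_spans t m'.
Proof.
move=> uv mm' [S [Sm SQ]]; apply: (@box_spans_superset_nonempty _ _ S) => //.
  by move=> j; rewrite (card_le_eql (Sm j)) card_le_II.
by left.
Qed.

(** * Existence of finite spanning boxes *)

(** A control that steers [x] into the interior of [Q] does so for all nearby states, by continuity;
    compactness then leaves finitely many controls. *)
Lemma finite_control_cover : exists2 D : set (product_control Sigma),
  finite_set D &
  forall x, Q x -> exists2 u, D u & Q° (product_step x u).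
Proof.
have [/compact_near_coveringP Qcov _ Qstep] := Q_inv.
(* Along [F], a property holds eventually if it holds for all supersets of some finite set of
   controls. Near-covering compactness turns the local choices of [D] into one uniform choice. *)
pose F := filter_from [set D : set (product_control Sigma) | finite_set D]
  (fun D => [set D' | D `<=` D']).
have FF : Filter F.
  apply: filter_from_filter; first by exists set0; exact: finite_set0.
  move=> A B fA fB; exists (A `|` B); first by rewrite /= finite_setU.
  by move=> D ABD; split=> u ?; apply: ABD; [left|right].
have /(Qcov _ _ _ FF) [D Dfin QD] : forall x, Q x ->
    \forall x' \near x & D \near F, exists2 u, D u & Q° (product_step x' u).
  move=> x /Qstep[u Qu].
  exists ([set y | Q° (product_step y u)], [set D | [set u] `<=` D]) => /=.
    split.
      have := @product_step_continuous _ _ u x Q°; apply.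
      by apply: open_nbhs_nbhs; split=> //; exact: open_interior.
    by exists [set u]; first exact: finite_set1.
  by move=> [y D] /= [Qy uD]; exists u => //; exact: uD.
by exists D => //; exact: QD.
Qed.

Lemma box_spans1 : exists m, box_spans 1 m.
Proof.
have [D Dfin DQ] := finite_control_cover.
(* Only the control at time 0 matters for one step, so constant sequences suffice. *)
pose S j := [set w : nat -> control (Sigma j) | exists2 u, D u & w = fun=> u j].
have /all_sig[m Sm] j : {p | S j #= `I_p}.
  apply: cid; apply: (@sub_finite_set _ _ ((fun u _ => u j) @` D)).
    by move=> w [u Du ->]; exists u.
  exact: finite_image.
exists m, S; split=> // x Qx; have [u Du uQ] := DQ _ Qx.
exists (fun j _ => u j); first by move=> j; exists u.
by move=> k; rewrite -eqn_leq => /eqP <-.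
Qed.

Lemma box_spans_exists t : exists m, box_spans t m.
Proof.
have [m bm] := box_spans1; exists (fun j => m j ^ t)%N.
by have := box_spansM t bm; rewrite muln1.
Qed.

(** * Minimal spanning sets *)

(** Minimality is stated against upper bounds [p] of the cardinality, so that it applies directly to
    images and boxes whose exact size is unknown. *)
Definition min_spanning t r :=
  (exists2 S, spanning t Q S & S #= `I_r) /\
  forall S p, spanning t Q S -> S #<= `I_p -> (r <= p)%N.

Lemma min_spanning_exists t : exists r, min_spanning t r.
Proof.
pose P r := `[< exists2 S, spanning t Q S & S #= `I_r >].
have P_le S p : spanning t Q S -> S #<= `I_p -> exists2 r, P r & (r <= p)%N.
  move=> SQ Sp; have /finite_setP[r Sr] : finite_set S.
    by apply/finite_set_leP; exists p.
  exists r; first by apply/asboolP; exists S.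
  by rewrite -card_le_II -(card_le_eql Sr).
have exP : exists r, P r.
  have [m [S [Sm SQ]]] := box_spans_exists t.
  by have [r Pr _] := P_le _ _ SQ (seq_box_card_le Sm); exists r.
case: (ex_minnP exP) => r /asboolP Sr rmin; exists r; split=> // S p SQ Sp.
by have [r' /rmin rr' r'p] := P_le _ _ SQ Sp; exact: leq_trans r'p.
Qed.

Lemma min_spanning_gt0 t r : min_spanning t r -> (0 < r)%N.
Proof.
move=> [[S /spanning_nonempty[w Sw]] + _].
rewrite lt0n; case: eqP => // ->; rewrite II0 card_eq0 => /eqP S0.
by move: Sw; rewrite S0.
Qed.

Lemma min_spanningD s t r r' r'' : min_spanning s r -> min_spanning t r' ->
  min_spanning (s + t) r'' -> (r'' <= r * r')%N.
Proof.
move=> [[S SQ Sr] _] [[S' SQ' Sr'] _] [_ min].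
have [w _] := spanning_nonempty SQ.
apply: (min [set (fun j => splice s (a j) (b j)) | a in S & b in S']).
  by apply: (spanning_splice SQ SQ') => a b Sa Sb; exists a => //; exists b.
have /card_eqPle[Sle _] := Sr; have /card_eqPle[S'le _] := Sr'.
by apply: card_image2_le.
Qed.

Lemma min_spanning_le_prod t r m : min_spanning t r -> box_spans t m ->
  (r <= \prod_j m j)%N.
Proof. by move=> [_ min] [S [/seq_box_card_le Sm SQ]]; exact: (min _ _ SQ). Qed.

Lemma min_spanning_box t r :
  (forall i, exists u v : control (Sigma i), u <> v) ->
  min_spanning t r -> box_spans t (fun=> r).
Proof.
move=> uv [[S SQ Sr] _].
(* The box of the projections of [S] contains [S], and each projection has at most [r] elements. *)
apply: (@box_spans_superset_nonempty _ _ (fun j => (@^~ j) @` S)); [|by left|].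
  by move=> j; rewrite -(card_le_eqr Sr); exact: card_image_le.
by move=> x /SQ[w Sw wQ]; exists w => // j; exists w.
Qed.

End spanning_boxes.

(** * Limits of subadditive sequences *)

Lemma subadditiveMD (R : realType) (a : nat -> R) :
  (forall s t, a (s + t)%N <= a s + a t) ->
  forall k m r, a (k * m + r)%N <= k%:R * a m + a r.
Proof.
move=> asub; elim=> [|k IHk] m r; first by rewrite mul0r add0r.
rewrite mulSn -addnA (le_trans (asub _ _))// mulrSr mulrDl mul1r.
by have := IHk m r; lra.
Qed.

(** Fekete's lemma: the limit is the infimum of the quotients. For [m] with a nearly optimal
    quotient, division of [n] by [m] bounds [a n] by the multiple of [a m] plus a remainder bounded
    independently of [n]. *)
Lemma fekete_subadditive_cvg (R : realType) (a : nat -> R) :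
  (forall n, 0 <= a n) -> (forall s t, a (s + t)%N <= a s + a t) ->
  exists2 L, (fun n => n%:R^-1 * a n) @ \oo --> L &
    forall n, (0 < n)%N -> L <= n%:R^-1 * a n.
Proof.
move=> a0 asub; pose A := [set n%:R^-1 * a n | n in [set n | (0 < n)%N]].
have Alb : has_lbound A.
  by exists 0 => _ [n _ <-]; rewrite mulr_ge0// invr_ge0.
have Ainf : has_inf A by split=> //; exists (1%:R^-1 * a 1%N); exists 1%N.
have infA n : (0 < n)%N -> inf A <= n%:R^-1 * a n.
  by move=> n0; apply: ge_inf => //; exists n.
exists (inf A) => //; apply/cvgrPdist_le => e e0.
have e2 : 0 < e / 2 by lra.
have [_ [m /= m0 <-] mA] := inf_adherent e2 Ainf.
(* [C] dominates the term of every possible remainder modulo [m]. *)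
pose C := \sum_(r < m) a r.
have C0 : 0 <= C by exact: sumr_ge0.
have aC r : (r < m)%N -> a r <= C.
  move=> rm; rewrite /C (bigD1 (Ordinal rm))//= lerDl.
  by apply: sumr_ge0.
(* Beyond this threshold [C / n] is at most [e / 2]. *)
exists (Num.bound (2 * C / e)).+1 => // n /= nC.
have n0 : (0 < n)%N by exact: leq_ltn_trans nC.
have nR : 0 < n%:R :> R by rewrite ltr0n.
have mR : 0 < m%:R :> R by rewrite ltr0n.
have Ce : C <= n%:R * (e / 2).
  have bC : 2 * C / e < (Num.bound (2 * C / e))%:R.
    by apply: archi_boundP; rewrite divr_ge0 ?mulr_ge0// ltW.
  have : 2 * C / e < n%:R by apply: (lt_trans bC); rewrite ltr_nat.
  by rewrite ltr_pdivrMr// => ?; lra.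
have an : a n <= n%:R * (m%:R^-1 * a m) + C.
  rewrite {1}(divn_eq n m) (le_trans (subadditiveMD asub _ _ _))//.
  apply: lerD; last by apply: aC; rewrite ltn_mod.
  rewrite mulrA ler_wpM2r// ler_pdivlMr// -natrM ler_nat.
  exact: leq_trunc_div.
rewrite distrC ger0_norm ?subr_ge0 ?infA//.
rewrite lerBlDr mulrC ler_pdivrMr//.
have : n%:R * (m%:R^-1 * a m) <= n%:R * (inf A + e / 2) by rewrite ler_wpM2l// ltW.
lra.
Qed.

(** * Closures, logarithms and approximation *)

Lemma closure_rowP (R : realType) n (A : set 'rV[R]_n) (x : 'rV[R]_n) :
  closure A x <-> forall e, 0 < e -> exists2 v, A v &
    forall j, `|x ord0 j - v ord0 j| < e.
Proof.
split=> [clA e e0|H B /nbhs_ballP[e /= e0 eB]].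
  have [v [Av [_ vx]]] := clA _ (nbhsx_ballx x e e0).
  by exists v => // j; exact: (vx ord0 j).
have [v Av vx] := H _ e0; exists v; split=> //; apply: eB; split=> // i j.
by rewrite (ord1 i); exact: vx.
Qed.

Section log2.
Variable R : realType.

Lemma ln2_gt0 : 0 < ln 2 :> R.
Proof. by apply: ln_gt0; rewrite ltr1n. Qed.

Lemma log2M (p q : nat) : (0 < p)%N -> (0 < q)%N ->
  log2 (p * q)%:R = log2 p%:R + log2 q%:R :> R.
Proof.
by move=> p0 q0; rewrite /log2 natrM lnM ?mulrDl// posrE ltr0n.
Qed.

Lemma log2X (p k : nat) : (0 < p)%N -> log2 (p ^ k)%:R = k%:R * log2 p%:R :> R.
Proof.
by move=> p0; rewrite /log2 natrX lnXn ?ltr0n// mulr_natl mulrnAl.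
Qed.

Lemma log2_prod n (m : 'I_n -> nat) : (forall j, 0 < m j)%N ->
  log2 (\prod_j m j)%:R = \sum_j log2 (m j)%:R :> R.
Proof.
move=> m0.
(* Positivity of the partial product is carried through the induction because [log2M] requires
   it. *)
suff [] : (0 < \prod_j m j)%N /\
    log2 (\prod_j m j)%:R = \sum_j log2 (m j)%:R :> R by [].
elim/big_rec2: _ => [|j p y _ [p0 <-]]; first by rewrite /log2 ln1 mul0r.
by rewrite muln_gt0 m0 p0 log2M.
Qed.

Lemma le_log2 (x y : R) : 0 < x -> x <= y -> log2 x <= log2 y.
Proof.
move=> x0 xy; rewrite /log2 ler_pM2r ?invr_gt0 ?ln2_gt0//.
by rewrite ler_ln// posrE (lt_le_trans x0).
Qed.

Lemma log2_ge0 p : (0 < p)%N -> 0 <= log2 p%:R :> R.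
Proof.
move=> p0; rewrite (_ : 0 = log2 1) ?le_log2 ?ler1n//.
by rewrite /log2 ln1 mul0r.
Qed.

Lemma log2_2 : log2 2 = 1 :> R.
Proof. by rewrite /log2 divff// gt_eqF// ln2_gt0. Qed.

Lemma log2_powR (y : R) : log2 (2 `^ y) = y.
Proof. by rewrite /log2 ln_powR mulfK// gt_eqF// ln2_gt0. Qed.

(** Take [p] to be the integer part of [2 ^ y]: then [p <= 2 ^ y < p + 1 <= 2 p], and doubling adds
    1 to the logarithm. *)
Lemma log2_approx (m : nat) (y : R) : (0 < m)%N -> log2 m%:R <= y ->
  exists2 p, (m <= p)%N & log2 p%:R <= y <= log2 p%:R + 1.
Proof.
move=> m0 my.
have m_le : m%:R <= 2 `^ y.
  have -> : m%:R = 2 `^ log2 m%:R :> R.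
    apply: ln_inj; rewrite ?posrE ?ltr0n ?powR_gt0//.
    by rewrite ln_powR /log2 divfK// gt_eqF// ln2_gt0.
  by rewrite ler_powR// ler1n.
pose p := Num.truncn (2 `^ y).
have mp : (m <= p)%N by rewrite truncn_ge_nat// powR_ge0.
have p0 : (0 < p)%N by exact: leq_trans mp.
exists p => //.
have /andP[py yp] : p%:R <= 2 `^ y < p.+1%:R.
  by apply: truncn_itv; exact: powR_ge0.
have -> : log2 p%:R + 1 = log2 (p * 2)%:R :> R by rewrite log2M// log2_2.
rewrite -{1 2}[y]log2_powR le_log2 ?ltr0n//=.
rewrite le_log2 ?powR_gt0// (le_trans (ltW yp))// ler_nat muln2 -addnn.
by rewrite -addn1 leq_add2l.
Qed.

End log2.

Lemma rational_approx (R : realType) (l e : R) : 0 <= l <= 1 -> 0 < e ->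
  exists p q, [/\ (0 < q)%N, (p <= q)%N & `|l - p%:R / q%:R| < e].
Proof.
move=> /andP[l0 l1] e0; pose q := (Num.bound e^-1).+1.
have qR : 0 < q%:R :> R by rewrite ltr0n.
have qe : 1 < q%:R * e.
  rewrite -ltr_pdivrMr// div1r.
  apply: (@lt_trans _ _ (Num.bound e^-1)%:R); last by rewrite ltr_nat.
  by apply: archi_boundP; rewrite invr_ge0 ltW.
have lq0 : 0 <= l * q%:R by rewrite mulr_ge0// ltW.
exists (Num.truncn (l * q%:R)), q; split=> //.
  rewrite -(ler_nat R) (@le_trans _ _ (l * q%:R)) ?truncn_le//.
  by rewrite ler_piMl// ltW.
have /andP[pl lp] := truncn_itv lq0.
rewrite ger0_norm; last by rewrite subr_ge0 ler_pdivrMr.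
rewrite -(ltr_pM2r qR) mulrBl divfK ?gt_eqF//.
by move: lp; rewrite -natr1; lra.
Qed.

(** * Entropy and the network entropy set *)

Section network_entropy.
Variables (R : realType) (n : nat) (Sigma : 'I_n -> control_system).
Variable Q : set (product_state Sigma).

Lemma mem_H t (v : 'rV[R]_n) : H_ R t Q v <->
  exists2 m, box_spans Q t m & v = \row_j (t%:R^-1 * log2 (m j)%:R).
Proof.
split=> [[S [_ SQ [m [Sm ->]]]]|[m [S [Sm SQ]] ->]].
  by exists m => //; exists S.
exists S; split=> //; last by exists m.
by apply/finite_set_leP; exists (\prod_j m j)%N; exact: seq_box_card_le.
Qed.

Lemma r_invE t r : min_spanning Q t r -> r_inv R t Q = r%:R%:E.
Proof.
move=> [[S SQ Sr] min]; apply/eqP; rewrite eq_le; apply/andP; split.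
  by apply: ereal_inf_lbound; exists r => //; exists S.
apply: le_ereal_inf_tmp => _ [p [S' SQ' /card_eqPle[S'p _]] <-].
by rewrite lee_fin ler_nat; exact: min S'p.
Qed.

Hypothesis Q_inv : controlled_invariant Q.

(** Splicing makes [log2 (r t)] subadditive, so Fekete's lemma gives a finite limit. That [h] is a
    lower bound at each positive time is used for (d), the convergence for (e). *)
Lemma h_inv_lim : exists r h, [/\ forall t, min_spanning Q t (r t),
  h_inv R Q = h%:E,
  (fun t => t%:R^-1 * log2 (r t)%:R) @ \oo --> (h : R) &
  forall t, (0 < t)%N -> h <= t%:R^-1 * log2 (r t)%:R].
Proof.
have [r rmin] := choice (min_spanning_exists Q_inv).
have r0 t : (0 < r t)%N by exact: (min_spanning_gt0 Q_inv (rmin t)).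
have [t|s t|h hlim hle] := @fekete_subadditive_cvg R (fun t => log2 (r t)%:R).
- by rewrite log2_ge0.
- rewrite -log2M// le_log2 ?ltr0n// ler_nat.
  exact: (min_spanningD Q_inv (rmin s) (rmin t) (rmin (s + t)%N)).
exists r, h; split=> //; rewrite /h_inv.
rewrite (_ : (fun t => _) = EFin \o (fun t => t%:R^-1 * log2 (r t)%:R)).
  by apply: cvg_lim => //; apply: cvg_EFin => //; exact: nearW.
by apply: funext => t /=; rewrite (r_invE (rmin t)) /= EFinM.
Qed.

Let V := \bigcup_(t in [set t | (0 < t)%N]) H_ R t Q.

(** Repeating a box [tau] times keeps its rates and makes its duration at least [tau]; hence the
    intersection defining the entropy set is over a constant family. *)
Lemma bigcup_H_tail tau : (0 < tau)%N ->
  \bigcup_(t in [set t | (tau <= t)%N]) H_ R t Q = V.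
Proof.
move=> tau0; apply/seteqP; split=> v [t /= tt Hv].
  by exists t => //=; exact: leq_trans tt.
move/mem_H : Hv => [m bm ->]; exists (tau * t)%N; first exact: leq_pmulr.
apply/mem_H; exists (fun j => m j ^ tau)%N; first exact: box_spansM.
apply/rowP => j; rewrite !mxE log2X ?(box_spans_gt0 Q_inv j bm)// natrM.
by field; rewrite !pnatr_eq0 -!lt0n tt tau0.
Qed.

Lemma network_entropy_setE : network_entropy_set R Q = closure V.
Proof.
apply/seteqP; split=> [v /(_ 1%N isT)|v Vv tau tau0].
  by rewrite bigcup_H_tail.
by rewrite bigcup_H_tail.
Qed.

Lemma rational_convex_combination (v w : 'rV[R]_n) p q : V v -> V w ->
  (0 < q)%N -> (p <= q)%N ->
  V (\row_j (p%:R / q%:R * v ord0 j + (1 - p%:R / q%:R) * w ord0 j)).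
Proof.
move=> [s /= s0 /mem_H[m bm ->]] [t /= t0 /mem_H[m' bm' ->]] q0 pq.
(* The first box, of duration [s], is repeated [p t] times and the second, of duration [t],
   [(q - p) s] times: they fill [p / q] and [1 - p / q] of the total time [q s t]. *)
exists (p * t * s + (q - p) * s * t)%N.
  rewrite /= -!mulnA [(t * s)%N]mulnC -mulnDl subnKC//.
  by rewrite !muln_gt0 q0 s0.
apply/mem_H; exists (fun j => m j ^ (p * t) * m' j ^ ((q - p) * s))%N.
  by apply: box_spansD => //; exact: box_spansM.
apply/rowP => j; rewrite !mxE.
have m0 := box_spans_gt0 Q_inv j bm; have m'0 := box_spans_gt0 Q_inv j bm'.
rewrite log2M ?expn_gt0 ?m0 ?m'0// !log2X// !natrD !natrM natrB//.
have sR : s%:R != 0 :> R by rewrite pnatr_eq0 -lt0n.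
have tR : t%:R != 0 :> R by rewrite pnatr_eq0 -lt0n.
have qR : q%:R != 0 :> R by rewrite pnatr_eq0 -lt0n.
rewrite (_ : p%:R * t%:R * s%:R + _ = q%:R * s%:R * t%:R); last by ring.
by field; rewrite sR tR qR.
Qed.

Lemma network_entropy_set_convex (x y : 'rV[R]_n) (l : R) : 0 <= l <= 1 ->
  closure V x -> closure V y -> closure V (l *: x + (1 - l) *: y).
Proof.
move=> l01 /closure_rowP Vx /closure_rowP Vy; apply/closure_rowP => e e0.
have e2 : 0 < e / 2 by lra.
have [v Vv xv] := Vx _ e2; have [w Vw yw] := Vy _ e2.
pose C := \sum_j `|v ord0 j - w ord0 j|.
have C0 : 0 <= C by exact: sumr_ge0.
have Cj j : `|v ord0 j - w ord0 j| <= C.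
  by rewrite /C (bigD1 j)//= lerDl sumr_ge0.
(* With weight error below [d], replacing [l] by a rational costs less than [e / 2]; [C + 1] avoids
   division by zero. *)
pose d := e / 2 / (C + 1).
have C1 : 0 < C + 1 by lra.
have d0 : 0 < d by rewrite divr_gt0.
have dC : d * C < e / 2.
  have dE : d * (C + 1) = e / 2 by rewrite /d divfK// gt_eqF.
  by move: dE; rewrite mulrDr mulr1; lra.
have [p [q [q0 pq]]] := rational_approx l01 d0; set a := p%:R / q%:R => la.
exists (\row_j (a * v ord0 j + (1 - a) * w ord0 j)).
  exact: rational_convex_combination.
move=> j; rewrite !mxE.
(* The first two errors are a convex combination of errors below [e / 2]; the third is the weight
   error. *)
have -> : l * x ord0 j + (1 - l) * y ord0 j - (a * v ord0 j + (1 - a) * w ord0 j) =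
    l * (x ord0 j - v ord0 j) + (1 - l) * (y ord0 j - w ord0 j) +
    (l - a) * (v ord0 j - w ord0 j) by ring.
have /andP[l0 l1] := l01; have l1' : 0 <= 1 - l by lra.
have h1 : `|l * (x ord0 j - v ord0 j)| <= l * (e / 2).
  by rewrite normrM ger0_norm// ler_wpM2l// ltW.
have h2 : `|(1 - l) * (y ord0 j - w ord0 j)| <= (1 - l) * (e / 2).
  by rewrite normrM ger0_norm// ler_wpM2l// ltW.
have h3 : `|(l - a) * (v ord0 j - w ord0 j)| < e / 2.
  by apply: le_lt_trans dC; rewrite normrM ler_pM// ltW.
rewrite (le_lt_trans (ler_normD _ _))//.
have := ler_normD (l * (x ord0 j - v ord0 j)) ((1 - l) * (y ord0 j - w ord0 j)).
lra.
Qed.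

Lemma network_entropy_set_up (x y : 'rV[R]_n) :
  (forall i, exists u v : control (Sigma i), u <> v) ->
  network_entropy_set R Q x -> (forall i, x ord0 i <= y ord0 i) ->
  network_entropy_set R Q y.
Proof.
move=> uv Hx xy; rewrite network_entropy_setE; apply/closure_rowP => e e0.
(* The tail starting beyond [1 / e] provides a time [t] with [1 / t < e], finer than the
   tolerance. *)
have /closure_rowP/(_ _ e0) [v [t /= et /mem_H[m bm ->]] xv] :=
  Hx (Num.bound e^-1).+1 isT.
have t0 : (0 < t)%N by exact: leq_ltn_trans et.
have tR : 0 < t%:R :> R by rewrite ltr0n.
have te : t%:R^-1 < e.
  rewrite invf_plt ?posrE//; apply: (@lt_trans _ _ (Num.bound e^-1)%:R).
    by apply: archi_boundP; rewrite invr_ge0 ltW.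
  by rewrite ltr_nat.
have /choice[p pP] j : exists p, (m j <= p)%N /\
    `|y ord0 j - t%:R^-1 * log2 p%:R| < e.
  (* If the rate of [m j] is at most [y_j], the side is enlarged. Otherwise [y_j] lies between [x_j]
     and that rate, which are within [e], and [m j] is kept. *)
  have [my|my] := lerP (log2 (m j)%:R) (t%:R * y ord0 j).
    have [p mp /andP[py yp]] := log2_approx (box_spans_gt0 Q_inv j bm) my.
    exists p; split=> //.
    have E : log2 p%:R = t%:R * (t%:R^-1 * log2 p%:R) :> R.
      by rewrite mulrA divff ?mul1r// gt_eqF.
    rewrite ger0_norm; last first.
      by rewrite subr_ge0 -(ler_pM2l tR) -E.
    apply: le_lt_trans te.
    by rewrite -(ler_pM2l tR) divff ?gt_eqF// mulrBr -E; lra.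
  exists (m j); split=> //; have := xv j; rewrite !mxE.
  have : y ord0 j < t%:R^-1 * log2 (m j)%:R.
    by rewrite mulrC ltr_pdivlMr// mulrC.
  by have := xy j; rewrite !ltr_norml => *; apply/andP; split; lra.
exists (\row_j (t%:R^-1 * log2 (p j)%:R)).
  exists t => //; apply/mem_H; exists p => //.
  by apply: (box_spans_le Q_inv uv _ bm) => j; have [] := pP j.
by move=> j; rewrite mxE; have [] := pP j.
Qed.

Lemma h_inv_le_sum (h : 'rV[R]_n) : closure V h ->
  (h_inv R Q <= (\sum_i h ord0 i)%:E)%E.
Proof.
move=> /closure_rowP Vh; have [r [l [rmin -> _ lr]]] := h_inv_lim.
rewrite lee_fin; apply/ler_addgt0Pr => e e0.
(* The [n] coordinate errors add up to at most [e]; [n + 1] keeps the divisor positive when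
   [n = 0]. *)
have en : 0 < e / n.+1%:R by rewrite divr_gt0.
have [_ [t /= t0 /mem_H[m bm ->]] hv] := Vh _ en.
have m0 j : (0 < m j)%N by exact: (box_spans_gt0 Q_inv j bm).
have tR : 0 < t%:R :> R by rewrite ltr0n.
rewrite (le_trans (lr _ t0))// (@le_trans _ _ (\sum_j t%:R^-1 * log2 (m j)%:R))//.
  rewrite -mulr_sumr -log2_prod// ler_pM2l ?invr_gt0// le_log2 ?ltr0n//.
    exact: (min_spanning_gt0 Q_inv (rmin t)).
  by rewrite ler_nat; exact: min_spanning_le_prod bm.
apply: (@le_trans _ _ (\sum_j (h ord0 j + e / n.+1%:R))).
  apply: ler_sum => j _; have := hv j; rewrite mxE ltr_norml.
  by move: (e / _) => d /andP[+ _]; lra.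
rewrite big_split/= lerD2l sumr_const card_ord -[leLHS]mulr_natr.
by rewrite -mulrA ler_piMr ?(ltW e0)// mulrC ler_pdivrMr// mul1r ler_nat.
Qed.

Lemma const_h_inv : (forall i, exists u v : control (Sigma i), u <> v) ->
  exists2 h : R, h_inv R Q = h%:E & closure V (const_mx h).
Proof.
move=> uv; have [r [h [rmin hE rh _]]] := h_inv_lim.
exists h => //; apply/closure_rowP => e e0.
(* Time [N + 1] is positive, as membership in [V] demands. *)
move/cvgrPdist_lt : rh => /(_ _ e0)[N _ /(_ N.+1 (leqnSn N)) /= hN].
exists (\row_j (N.+1%:R^-1 * log2 (r N.+1)%:R)).
  exists N.+1 => //; apply/mem_H; exists (fun=> r N.+1) => //.
  exact: min_spanning_box.
by move=> j; rewrite !mxE.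
Qed.

End network_entropy.

(** * Assertions (a) to (e) *)

Theorem propositionV3 (R : realType) (n : nat) (n_gt0 : (0 < n)%N)
    (Sigma : 'I_n -> control_system) (Q : set (product_state Sigma))
    (Q_inv : controlled_invariant Q) :
  let H : set 'rV[R]_n := network_entropy_set R Q in
  [/\ (* (a) *)
      [/\ H = closure (\bigcup_(tau in [set tau | (0 < tau)%N]) H_ R tau Q),
          H !=set0 & closed H],
      (* (b) *)
      (forall i, exists u v : control (Sigma i), u <> v) ->
        (forall xi eta : 'rV[R]_n, H xi ->
          (forall i, xi ord0 i <= eta ord0 i) -> H eta) /\
        ~ bounded_set H,
      (* (c) *)
      convex_set (H : set (convex_lmodType 'rV[R]_n)),
      (* (d) *)
      forall h : 'rV[R]_n, H h -> (h_inv R Q <= (\sum_i h ord0 i)%:E)%E &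
      (* (e) *)
      (forall i, exists u v : control (Sigma i), u <> v) ->
        exists2 h : R, h_inv R Q = h%:E & H (const_mx h)].
Proof.
move=> H; have HE : H = _ := network_entropy_setE R Q_inv.
have H0 : H !=set0.
  have [m bm] := box_spans1 Q_inv.
  exists (\row_j (1%:R^-1 * log2 (m j)%:R)); rewrite HE; apply: subset_closure.
  by exists 1%N => //; apply/mem_H; exists m.
split.
- by split=> //; rewrite HE; exact: closed_closure.
- move=> uv; have up xi eta := @network_entropy_set_up R n Sigma Q Q_inv xi eta uv.
  split; first exact: up.
  move=> [M [_ HM]]; have [x Hx] := H0; have [x0 _] : {x0 : 'I_n | True}.
    by exists (Ordinal n_gt0).
  (* [y] dominates [x], hence lies in [H], but its entries exceed the bound [|M| + 1] on the
     norm. *)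
  pose y : 'rV[R]_n := \row_j (`|x ord0 j| + `|M| + 2).
  have Hy : H y.
    apply: up Hx _ => i; rewrite mxE.
    by have := ler_norm (x ord0 i); have := normr_ge0 M; lra.
  have M1 : M < `|M| + 1 by have := ler_norm M; lra.
  have /= yM := HM _ M1 _ Hy.
  have : `|y ord0 x0| <= `|y|.
    rewrite [leRHS]/Num.norm/= mx_normrE.
    exact: (le_bigmax _ (fun i => `|y i.1 i.2|) (ord0, x0)).
  rewrite mxE ger0_norm; last by have := normr_ge0 M; have := normr_ge0 (x ord0 x0); lra.
  by have := normr_ge0 (x ord0 x0); lra.
- move=> x y l; rewrite !inE HE => Vx Vy.
  by apply: network_entropy_set_convex => //; rewrite ge0 le1.
- by move=> h; rewrite HE; exact: h_inv_le_sum.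
- by rewrite HE; exact: const_h_inv.
Qed.
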